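(* Let $\mathsf C$ be a grouplike category with two objects $X,Y$, with $\mathsf C(X,X)=G_1^{*k_1}$, $\mathsf C(Y,Y)=G_2^{*k_2}$, $L=\mathsf C(X,Y)\neq\emptyset$ and $R=\mathsf C(Y,X)\ne\emptyset$. Then $\mathsf C$ comes from the following construction. There exist an integer $i$ with $0\le i\le\min(k_1,k_2)$ and a group isomorphism $G_1\simeq G_2$ such that, after identifying both groups with one group $G$ via this isomorphism, $L$ and $R$ are strongly $i$-unigen bimodules and, for suitable bimodule isomorphisms $L_i\simeq G^{*i}$ and $R_i\simeq G^{*i}$, the category $\mathsf C$ is the category $\mathsf C^{(3)}$ constructed from $(G,i,k_1,k_2,L,R)$ and these isomorphisms (as described in the context).
   Context: Composition is written diagrammatically: for $f\in\mathsf C(X,Y)$ and $g\in\mathsf C(Y,Z)$ the composite is $f\cdot g\in\mathsf C(X,Z)$. For a group $G$ with identity $e_0$ and $k\ge 0$, $G^{*k}$ is the monoid $G\sqcup\{e_1,\dots,e_k\}$ whose multiplication extends that of $G$, with $e_j g=g e_j=g$ for $g\in G$ and $e_j e_l=e_{\min(j,l)}$; its identity is $e_k$. For $i\le k$, $G^{*i}$ is viewed as the subset $G\cup\{e_1,\dots,e_i\}$ (a two-sided ideal) of $G^{*k}$, so $G^{*k}$ acts on $G^{*i}$ on both sides by multiplication. Such monoids are called grouplike, and a grouplike category is a finite category whose endomorphism monoids are grouplike. Write $e_0,\dots,e_{k_1}$ for the idempotents of $G_1^{*k_1}$ and $f_0,\dots,f_{k_2}$ for those of $G_2^{*k_2}$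 ($e_0,f_0$ the group identities). An $(A,B)$-bimodule for monoids $A,B$ is a set with a left unital $A$-action and a right unital $B$-action that commute; $L$ is a $(G_1^{*k_1},G_2^{*k_2})$-bimodule and $R$ a $(G_2^{*k_2},G_1^{*k_1})$-bimodule via composition. For $i\le k_1,k_2$, a $(G^{*k_1},G^{*k_2})$-bimodule $L$ is strongly $i$-unigen if $L\cdot f_i=e_i\cdot L=:L_i$ and $L_i\simeq G^{*i}$ as a $(G^{*k_1},G^{*k_2})$-bimodule, both actions on $G^{*i}$ being by multiplication. The same definition applies to a $(G^{*k_2},G^{*k_1})$-bimodule $R$, with $R_i:=R\cdot e_i=f_i\cdot R$. Construction of $\mathsf C^{(3)}$: given strongly $i$-unigen bimodules $L$, $R$ and bimodule isomorphisms $L_i\simeq G^{*i}$, $R_i\simeq G^{*i}$, $\mathsf C^{(3)}$ is the category with objects $X,Y$ and hom-sets $\mathsf C^{(3)}(X,X)=G^{*k_1}$, $\mathsf C^{(3)}(X,Y)=L$, $\mathsf C^{(3)}(Y,X)=R$, $\mathsf C^{(3)}(Y,Y)=G^{*k_2}$; compositions inside $G^{*k_1}$ and $G^{*k_2}$ are the monoid multiplications, compositions of these with $L$ and $R$ are given by the bimodule structures, and for $x\in L$, $y\in R$ one sets $x\cdot y:=(e_i\cdot x)(y\cdot e_i)\in G^{*i}\subseteq G^{*k_1}$ and $y\cdot x:=(f_i\cdot y)(x\cdot f_i)\in G^{*i}\subseteq G^{*k_2}$, where the products on the right are taken in $G^{*i}$ via $L_i\simeq G^{*i}\simeq R_i$.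 *)

(* Defs.v *)
From HB Require Import structures.
From mathcomp Require Import all_boot all_fingroup.

Set Implicit Arguments.
Unset Strict Implicit.
Unset Printing Implicit Defensive.

Local Open Scope group_scope.

Notation monoid_hom := UMagmaMorphism.type.

(* The monoid G^{*k}: [inl g] is the group element g and [inr j], with j < k,
   is the idempotent e_(j+1); the remaining idempotent e_0 is [inl 1]. *)
Definition star (G : finGroupType) (k : nat) : Type := (G + 'I_k)%type.
HB.instance Definition _ (G : finGroupType) (k : nat) :=
  Finite.on (star G k).

Section Star.
Variable G : finGroupType.

Definition star_e (k i : nat) : i <= k -> star G k :=
  match i with
  | 0 => fun _ => inl 1
  | j.+1 => fun lt_jk => inr (Ordinal lt_jk)
  end.
Arguments star_e k [i].

Definition ord_minl (i k : nat) (j : 'I_i) (l : 'I_k) : 'I_i :=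
  Ordinal (leq_ltn_trans (geq_minl j l) (ltn_ord j)).
Definition ord_minr (k i : nat) (j : 'I_k) (l : 'I_i) : 'I_i :=
  Ordinal (leq_ltn_trans (geq_minr j l) (ltn_ord l)).

(* Multiplication of an element of G^{*k} with one of G^{*i}, the result lying
   in G^{*i}. For i <= k this is the product of G^{*k} restricted to its ideal
   G^{*i}: see [star_incl_lmul] and [star_incl_rmul]. *)
Definition star_lmul (k i : nat) (a : star G k) (x : star G i) : star G i :=
  match a, x with
  | inl g, inl h => inl (g * h)
  | inl g, inr _ => inl g
  | inr _, inl h => inl h
  | inr j, inr l => inr (ord_minr j l)
  end.
Definition star_rmul (i k : nat) (x : star G i) (b : star G k) : star G i :=
  match x, b with
  | inl g, inl h => inl (g * h)
  | inl g, inr _ => inl g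
  | inr _, inl h => inl h
  | inr j, inr l => inr (ord_minl j l)
  end.

Definition star_incl (i k : nat) (le_ik : i <= k) (x : star G i) : star G k :=
  match x with
  | inl g => inl g
  | inr j => inr (widen_ord le_ik j)
  end.

Lemma star_lmulA k l i (a : star G k) (b : star G l) (x : star G i) :
  star_lmul a (star_lmul b x) = star_lmul (star_lmul a b) x.
Proof.
case: a b x => [a|a] [b|b] [x|x] //=; rewrite ?mulgA //.
by congr inr; apply: val_inj; rewrite /= minnA.
Qed.

Lemma star_rmulA k l i (x : star G i) (a : star G k) (b : star G l) :
  star_rmul (star_rmul x a) b = star_rmul x (star_rmul a b).
Proof.
case: a b x => [a|a] [b|b] [x|x] //=; rewrite ?mulgA //.
by congr inr; apply: val_inj; rewrite /= minnA.
Qed.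

Lemma star_lrmulA k l i (a : star G k) (x : star G i) (b : star G l) :
  star_lmul a (star_rmul x b) = star_rmul (star_lmul a x) b.
Proof.
case: a b x => [a|a] [b|b] [x|x] //=; rewrite ?mulgA //.
by congr inr; apply: val_inj; rewrite /= minnA.
Qed.

Lemma star_lrmulE k (a b : star G k) : star_lmul a b = star_rmul a b.
Proof. by case: a b => [a|a] [b|b] //=; congr inr; apply: val_inj. Qed.

Lemma star_lmul_e k i l (le_lk : l <= k) (x : star G i) : i <= l ->
  star_lmul (star_e k le_lk) x = x.
Proof.
case: l le_lk => [|l] le_lk; case: x => [x|x] //= le_il; rewrite ?mul1g //.
  by case: x => x lt_xi; move: (leq_trans lt_xi le_il).
congr inr; apply: val_inj; apply/minn_idPr => /=.
by rewrite -ltnS (leq_trans (ltn_ord x) le_il).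
Qed.

Lemma star_rmul_e k i l (le_lk : l <= k) (x : star G i) : i <= l ->
  star_rmul x (star_e k le_lk) = x.
Proof.
case: l le_lk => [|l] le_lk; case: x => [x|x] //= le_il; rewrite ?mulg1 //.
  by case: x => x lt_xi; move: (leq_trans lt_xi le_il).
congr inr; apply: val_inj; apply/minn_idPl => /=.
by rewrite -ltnS (leq_trans (ltn_ord x) le_il).
Qed.

Lemma star_lmul_rmul k i (x : star G i) (a : star G k) (y : star G i) :
  star_lmul (star_rmul x a) y = star_lmul x (star_lmul a y).
Proof.
case: a x y => [a|a] [x|x] [y|y] //=; rewrite ?mulgA //.
by congr inr; apply: val_inj; rewrite /= minnA.
Qed.

Lemma star_mulA k : associative (@star_lmul k k).
Proof. by move=> a b c; rewrite star_lmulA. Qed.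
Lemma star_mul1 k : left_id (star_e k (leqnn k)) (@star_lmul k k).
Proof. by move=> a; rewrite star_lmul_e. Qed.
Lemma star_1mul k : right_id (star_e k (leqnn k)) (@star_lmul k k).
Proof. by move=> a; rewrite star_lrmulE star_rmul_e. Qed.

HB.instance Definition _ (k : nat) :=
  isMonoid.Build (star G k) (@star_mulA k) (@star_mul1 k) (@star_1mul k).

Lemma star_mulE k (a b : star G k) : a * b = star_lmul a b.
Proof. by []. Qed.

Lemma star_oneE k : 1 = star_e k (leqnn k).
Proof. by []. Qed.

Lemma star_incl_inj i k (le_ik : i <= k) : injective (star_incl le_ik).
Proof.
case=> [x|x] [y|y] //= [] E; first by rewrite E.
by congr inr; apply: val_inj.
Qed.

Lemma star_incl_lmul i k (le_ik : i <= k) (a : star G k) (x : star G i) :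
  star_incl le_ik (star_lmul a x) = a * star_incl le_ik x.
Proof.
by case: a x => [a|a] [x|x] //=; congr inr; apply: val_inj.
Qed.

Lemma star_incl_rmul i k (le_ik : i <= k) (x : star G i) (b : star G k) :
  star_incl le_ik (star_rmul x b) = star_incl le_ik x * b.
Proof.
by case: b x => [b|b] [x|x] //=; congr inr; apply: val_inj.
Qed.

Lemma star_inclM i k (le_ik : i <= k) (x y : star G i) :
  star_incl le_ik (x * y) = star_incl le_ik x * star_incl le_ik y.
Proof.
by case: x y => [x|x] [y|y] //=; congr inr; apply: val_inj.
Qed.

Lemma star_lmul_incl i k l (le_ik : i <= k) (a : star G i) (x : star G l) :
  star_lmul (star_incl le_ik a) x = star_lmul a x.
Proof.
by case: a x => [a|a] [x|x] //=; congr inr; apply: val_inj.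
Qed.

Lemma star_rmul_incl i k l (le_ik : i <= k) (x : star G l) (a : star G i) :
  star_rmul x (star_incl le_ik a) = star_rmul x a.
Proof.
by case: a x => [a|a] [x|x] //=; congr inr; apply: val_inj.
Qed.

End Star.
Arguments star_e {G} k [i].

(* The isomorphism G^{*k} ~ H^{*k} induced by psi : G ~ H, fixing each e_j with
   j > 0; it is used to identify G_2^{*k_2} with G_1^{*k_2}. *)
Section StarMap.
Variables (G H : finGroupType) (psi : monoid_hom G H).

Definition star_map (k : nat) (x : star G k) : star H k :=
  match x with
  | inl g => inl (psi g)
  | inr j => inr j
  end.

Lemma star_map_monoid k : monoid_morphism (@star_map k).
Proof.
split; first by case: k => [|k] //; congr inl; apply: gmulf1.
move=> [a|a] [b|b] //; congr inl; exact: gmulfM.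
Qed.

HB.instance Definition _ (k : nat) :=
  isUMagmaMorphism.Build (star G k) (star H k) (@star_map k)
    (star_map_monoid k).

End StarMap.
Arguments star_map {G H} psi k.

Record bimodule (A B : monoidType) := Bimodule {
  bimod_set :> finType;
  lact : A -> bimod_set -> bimod_set;
  ract : bimod_set -> B -> bimod_set;
  lact1 : forall x, lact 1 x = x;
  lactM : forall a b x, lact (a * b) x = lact a (lact b x);
  ract1 : forall x, ract x 1 = x;
  ractM : forall x a b, ract x (a * b) = ract (ract x a) b;
  lractA : forall a x b, ract (lact a x) b = lact a (ract x b)
}.

Record bimod_iso (A B : monoidType) (M N : bimodule A B) := BimodIso {
  bimod_fun :> M -> N;
  bimod_bij : bijective bimod_fun;
  bimod_lact : forall a x, bimod_fun (lact a x) = lact a (bimod_fun x);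
  bimod_ract : forall x b, bimod_fun (ract x b) = ract (bimod_fun x) b
}.

Section SubBimodule.
Variables (A B : monoidType) (M : bimodule A B) (e : A) (f : B).

Definition lpart : {set M} := [set lact e x | x : M].
Definition rpart : {set M} := [set ract x f | x : M].

Lemma lact_lpart x : lact e x \in lpart.
Proof. exact: imset_f. Qed.

Hypothesis eq_parts : rpart = lpart.

Lemma ract_lpart x : ract x f \in lpart.
Proof. by rewrite -eq_parts imset_f. Qed.

Lemma lpart_lact a (x : {x : M | x \in lpart}) : lact a (val x) \in lpart.
Proof.
case: x => x /=; rewrite -{1}eq_parts => /imsetP[y _ ->].
by rewrite -lractA ract_lpart.
Qed.

Lemma lpart_ract (x : {x : M | x \in lpart}) b : ract (val x) b \in lpart.
Proof.
by case: x => x /= /imsetP[y _ ->]; rewrite lractA lact_lpart.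
Qed.

(* The sub-bimodule e M = M f of M. *)
Definition sub_bimod : bimodule A B.
Proof.
refine (@Bimodule A B {x : M | x \in lpart}
  (fun a x => exist (fun x => x \in lpart) _ (lpart_lact a x))
  (fun x b => exist (fun x => x \in lpart) _ (lpart_ract x b)) _ _ _ _ _).
- by move=> x; apply: val_inj; apply: lact1.
- by move=> a b x; apply: val_inj; apply: lactM.
- by move=> x; apply: val_inj; apply: ract1.
- by move=> x a b; apply: val_inj; apply: ractM.
- by move=> a x b; apply: val_inj; apply: lractA.
Defined.

Definition lpart_of (x : M) : sub_bimod := exist (fun x => x \in lpart) _ (lact_lpart x).
Definition rpart_of (x : M) : sub_bimod := exist (fun x => x \in lpart) _ (ract_lpart x).

End SubBimodule.

Section Unigen.
Variables (G : finGroupType) (i k1 k2 : nat).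
Hypotheses (le_i1 : i <= k1) (le_i2 : i <= k2).

Definition star_bimod : bimodule (star G k1) (star G k2).
Proof.
refine (@Bimodule (star G k1) (star G k2) (star G i)
  (@star_lmul G k1 i) (@star_rmul G i k2) _ _ _ _ _).
- by move=> x; apply: star_lmul_e.
- by move=> a b x; rewrite star_lmulA.
- by move=> x; apply: star_rmul_e.
- by move=> x a b; rewrite star_rmulA -star_lrmulE.
- by move=> a x b; rewrite star_lrmulA.
Defined.

(* For M strongly i-unigen, a chosen isomorphism M_i ~ G^{*i}. *)
Record unigen_iso (M : bimodule (star G k1) (star G k2)) := UnigenIso {
  unigen_eq : rpart M (star_e k2 le_i2) = lpart M (star_e k1 le_i1);
  unigen_fun :> bimod_iso (sub_bimod unigen_eq) star_bimod
}.

Definition strongly_unigen (M : bimodule (star G k1) (star G k2)) : Prop :=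
  inhabited (unigen_iso M).

(* x |-> e_i . x and x |-> x . f_i, read in G^{*i} through M_i ~ G^{*i}. *)
Definition unigen_l M (u : unigen_iso M) (x : M) : star G i :=
  u (lpart_of (unigen_eq u) x).
Definition unigen_r M (u : unigen_iso M) (x : M) : star G i :=
  u (rpart_of (unigen_eq u) x).

Lemma unigen_lrE M (u : unigen_iso M) x : unigen_l u x = unigen_r u x.
Proof.
have E : lact (star_e k1 le_i1) (rpart_of (unigen_eq u) x) =
         ract (lpart_of (unigen_eq u) x) (star_e k2 le_i2).
  by apply: val_inj => /=; rewrite lractA.
have := congr1 u E; rewrite bimod_lact bimod_ract /=.
by rewrite star_lmul_e // star_rmul_e.
Qed.

Lemma unigen_l_lact M (u : unigen_iso M) a x :
  unigen_l u (lact a x) = star_lmul a (unigen_l u x).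
Proof.
rewrite !unigen_lrE /unigen_r.
have -> : rpart_of (unigen_eq u) (lact a x) =
          lact a (rpart_of (unigen_eq u) x).
  by apply: val_inj; rewrite /= lractA.
exact: (bimod_lact (unigen_fun u)).
Qed.

Lemma unigen_l_ract M (u : unigen_iso M) x b :
  unigen_l u (ract x b) = star_rmul (unigen_l u x) b.
Proof.
rewrite /unigen_l.
have -> : lpart_of (unigen_eq u) (ract x b) =
          ract (lpart_of (unigen_eq u) x) b.
  by apply: val_inj; rewrite /= lractA.
exact: (bimod_ract (unigen_fun u)).
Qed.

Lemma unigen_inj M (u : unigen_iso M) (x y : sub_bimod (unigen_eq u)) :
  u x = u y -> val x = val y.
Proof. by case: (bimod_bij u) => v uK _ /(can_inj uK) ->. Qed.

Lemma unigen_ract_lact M (u : unigen_iso M) x y (s : star G i) :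
  ract x (star_incl le_i2 (s * unigen_l u y)) =
  lact (star_incl le_i1 (unigen_l u x * s)) y.
Proof.
have rE t : star_e k2 le_i2 * star_incl le_i2 t = star_incl le_i2 t.
  by rewrite -star_incl_lmul star_lmul_e.
have lE t : star_incl le_i1 t * star_e k1 le_i1 = star_incl le_i1 t.
  by rewrite -star_incl_rmul star_rmul_e.
rewrite -rE ractM -lE lactM.
apply: (unigen_inj (u := u)
  (x := ract (rpart_of (unigen_eq u) x) (star_incl le_i2 _))
  (y := lact (star_incl le_i1 _) (lpart_of (unigen_eq u) y))).
rewrite bimod_lact bimod_ract /= -/(unigen_l u y) -/(unigen_r u x).
by rewrite -unigen_lrE star_lmul_incl star_rmul_incl -star_lrmulE !star_mulE star_lmulA.
Qed.

End Unigen.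

(* Categories with a finite set [ob] of objects and finite hom-sets;
   [comp f g] is the diagrammatic composite f . g. *)
Record fincat (ob : finType) := FinCat {
  hom :> ob -> ob -> finType;
  idm : forall x, hom x x;
  comp : forall x y z, hom x y -> hom y z -> hom x z;
  comp1m : forall x y (f : hom x y), comp (idm x) f = f;
  compm1 : forall x y (f : hom x y), comp f (idm y) = f;
  compA : forall x y z t (f : hom x y) (g : hom y z) (h : hom z t),
    comp f (comp g h) = comp (comp f g) h
}.

Definition endo (ob : finType) (C : fincat ob) (x : ob) : Type := C x x.
HB.instance Definition _ (ob : finType) (C : fincat ob) (x : ob) :=
  Finite.on (endo C x).
HB.instance Definition _ (ob : finType) (C : fincat ob) (x : ob) :=
  isMonoid.Build (endo C x) (@compA ob C x x x x)
    (@comp1m ob C x x) (@compm1 ob C x x).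

(* C(x, y) as an (A, B)-bimodule, A and B acting by composition through the
   given monoid morphisms. *)
Definition hom_bimod (ob : finType) (C : fincat ob) (x y : ob)
  (A B : monoidType) (a : monoid_hom A (endo C x))
  (b : monoid_hom B (endo C y)) : bimodule A B.
Proof.
refine (@Bimodule A B (C x y)
  (fun s (f : C x y) => comp (a s : C x x) f)
  (fun (f : C x y) t => comp f (b t : C y y)) _ _ _ _ _).
- by move=> f; rewrite gmulf1; apply: comp1m.
- by move=> s t f; rewrite gmulfM compA.
- by move=> f; rewrite gmulf1; apply: compm1.
- by move=> f s t; rewrite gmulfM compA.
- by move=> s f t; rewrite compA.
Defined.

(* Isomorphisms of categories that are the identity on objects. *)
Record cat_iso (ob : finType) (C D : fincat ob) := CatIso {
  cat_fun :> forall x y, C x y -> D x y;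
  cat_bij : forall x y, bijective (@cat_fun x y);
  cat_id : forall x, cat_fun (idm C x) = idm D x;
  cat_comp : forall x y z (f : C x y) (g : C y z),
    cat_fun (comp f g) = comp (cat_fun f) (cat_fun g)
}.

(* The set of objects of a category with two objects X and Y. *)
Inductive two : Type := X | Y.

Definition two_to_bool (x : two) : bool := if x is X then true else false.
Definition bool_to_two (b : bool) : two := if b then X else Y.
Lemma two_to_boolK : cancel two_to_bool bool_to_two. Proof. by case. Qed.
HB.instance Definition _ := Finite.copy two (can_type two_to_boolK).

Section C3.
Variables (G : finGroupType) (i k1 k2 : nat).
Hypotheses (le_i1 : i <= k1) (le_i2 : i <= k2).
Variables (L : bimodule (star G k1) (star G k2)).
Variables (R : bimodule (star G k2) (star G k1)).
Variables (uL : unigen_iso le_i1 le_i2 L) (uR : unigen_iso le_i2 le_i1 R).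

Definition C3_hom (x y : two) : finType :=
  match x, y with
  | X, X => star G k1
  | X, Y => L
  | Y, X => R
  | Y, Y => star G k2
  end.

Definition C3_id (x : two) : C3_hom x x :=
  match x with
  | X => (1 : star G k1)
  | Y => (1 : star G k2)
  end.

Definition C3_comp (x y z : two) : C3_hom x y -> C3_hom y z -> C3_hom x z :=
  match x, y, z with
  | X, X, X => fun a b : star G k1 => a * b
  | Y, Y, Y => fun a b : star G k2 => a * b
  | X, X, Y => fun (a : star G k1) (l : L) => lact a l
  | X, Y, Y => fun (l : L) (b : star G k2) => ract l b
  | Y, Y, X => fun (b : star G k2) (r : R) => lact b r
  | Y, X, X => fun (r : R) (a : star G k1) => ract r a
  | X, Y, X => fun (l : L) (r : R) =>
      star_incl le_i1 (unigen_l uL l * unigen_r uR r)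
  | Y, X, Y => fun (r : R) (l : L) =>
      star_incl le_i2 (unigen_l uR r * unigen_r uL l)
  end.

Lemma C3_comp1m x y (f : C3_hom x y) : C3_comp (C3_id x) f = f.
Proof.
case: x y f => [] [] f /=; by [exact: mul1g | exact: lact1].
Qed.

Lemma C3_compm1 x y (f : C3_hom x y) : C3_comp f (C3_id y) = f.
Proof.
case: x y f => [] [] f /=; by [exact: mulg1 | exact: ract1].
Qed.

Lemma C3_compA x y z t (f : C3_hom x y) (g : C3_hom y z) (h : C3_hom z t) :
  C3_comp f (C3_comp g h) = C3_comp (C3_comp f g) h.
Proof.
case: x y z t f g h => [] [] [] [] f g h /=;
  rewrite ?mulgA ?lactM ?ractM ?lractA //.
- by rewrite unigen_l_lact -star_incl_lmul !star_mulE star_lmulA.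
- rewrite -!(unigen_lrE uR) unigen_l_ract -star_incl_rmul.
  by rewrite !star_mulE !star_lrmulA.
- by rewrite -(unigen_lrE uL) -(unigen_lrE uR) unigen_ract_lact.
- rewrite -!(unigen_lrE uR) unigen_l_lact unigen_l_ract !star_mulE.
  by rewrite star_lmul_rmul.
- rewrite -!(unigen_lrE uL) unigen_l_lact unigen_l_ract !star_mulE.
  by rewrite star_lmul_rmul.
- by rewrite -(unigen_lrE uL) -(unigen_lrE uR) unigen_ract_lact.
- rewrite -!(unigen_lrE uL) unigen_l_ract -star_incl_rmul.
  by rewrite !star_mulE !star_lrmulA.
- by rewrite unigen_l_lact -star_incl_lmul !star_mulE star_lmulA.
Qed.

Definition C3 : fincat two := FinCat C3_comp1m C3_compm1 C3_compA.

End C3.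

(* Main.v *)
From HB Require Import structures.
From mathcomp Require Import all_boot all_fingroup.
Require Import Defs.

(* Among the composites C(X, Y) C(Y, X) pick one of maximal rank; up to a group
   element it is an idempotent e_i = x y, and y x is then an idempotent f_m.
   Conjugation a |-> y a x is an isomorphism e_i C(X, X) e_i ~ f_m C(Y, Y) f_m,
   that is, G_1^{*i} ~ G_2^{*m}; such an isomorphism maps groups to groups and
   preserves the chain of idempotents, so i = m and it is induced by some
   psi : G_1 ~ G_2. Then l |-> l y and r |-> x r are the isomorphisms
   L_i ~ G^{*i} and R_i ~ G^{*i}, and l r = (l y)(x r) because e_i and f_i act
   trivially on all composites. *)

Set Implicit Arguments.
Unset Strict Implicit.
Unset Printing Implicit Defensive.

Local Open Scope group_scope.

(** * Rank, ideals and idempotents of G^{*k} *)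

Section StarTheory.
Variable G : finGroupType.
Implicit Types i k : nat.

(** The whole group has rank 0 and e_j has rank j, so the ideal G^{*i} consists of the elements of
    rank at most i, exactly those fixed by e_i. *)
Definition star_rank k (a : star G k) : nat := if a is inr j then j.+1 else 0.

(** For i <= k this is the retraction a |-> a e_i onto the ideal G^{*i}; [star_lmul] lets it be
    written without a proof of i <= k. *)
Definition star_proj k i (a : star G k) : star G i := star_lmul a (1 : star G i).

Lemma star_rank_le k (a : star G k) : star_rank a <= k.
Proof. by case: a => [g|j] //; apply: ltn_ord. Qed.

Lemma star_rank_e k i (le_ik : i <= k) : star_rank (star_e (G := G) k le_ik) = i.
Proof. by case: i le_ik. Qed.

Lemma star_incl1 k i (le_ik : i <= k) :
  star_incl le_ik (1 : star G i) = star_e k le_ik.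
Proof.
rewrite star_oneE; case: i le_ik => [|i] //= le_ik.
by congr inr; apply: val_inj.
Qed.

Lemma star_projK k i (le_ik : i <= k) (a : star G k) :
  star_incl le_ik (star_proj i a) = a * star_e k le_ik.
Proof. by rewrite star_incl_lmul star_incl1. Qed.

Lemma star_mul_e_id k i (le_ik : i <= k) (a : star G k) :
  star_rank a <= i -> a * star_e k le_ik = a.
Proof.
rewrite star_mulE star_lrmulE; case: i a le_ik => [|i] [g|j] //= le_ik le_ji.
  by rewrite mulg1.
by congr inr; apply: val_inj; apply/minn_idPl.
Qed.

Lemma star_e_central k i (le_ik : i <= k) (a : star G k) :
  star_e k le_ik * a = a * star_e k le_ik.
Proof.
rewrite !star_mulE; case: i a le_ik => [|i] [g|j] //= le_ik.
  by rewrite mulg1 mul1g.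
by congr inr; apply: val_inj; apply: minnC.
Qed.

Lemma star_eM k i (le_ik : i <= k) :
  star_e (G := G) k le_ik * star_e k le_ik = star_e k le_ik.
Proof. by rewrite star_mul_e_id ?star_rank_e. Qed.

Lemma star_incl_e k i (le_ik : i <= k) (a : star G i) :
  star_incl le_ik a * star_e k le_ik = star_incl le_ik a.
Proof. by rewrite star_mul_e_id //; case: a => //= j; apply: ltn_ord. Qed.

Lemma star_idem k (a : star G k) :
  a * a = a -> exists i (le_ik : i <= k), a = star_e k le_ik.
Proof.
case: a => [g|j]; last first.
  by move=> _; exists j.+1, (ltn_ord j) => /=; congr inr; apply: val_inj.
move=> []/(canRL (mulKg _)); rewrite mulVg => ->.
by exists 0, (leq0n k).
Qed.

End StarTheory.

(** * Isomorphisms between the monoids G^{*i} and H^{*m} *)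

Section StarIso.

(** The group is an ideal of G^{*i}. By surjectivity some preimage of 1, times [inl g], is a group
    element with image in H; every group element is a multiple of that one, so its image lies in the
    ideal H as well. *)
Lemma star_morph_inl (G H : finGroupType) i m (f : star G i -> star H m)
    (f' : star H m -> star G i) :
  {morph f : a b / a * b} -> cancel f' f ->
  forall g, exists h, f (inl g) = inl h.
Proof.
move=> fM f'K g.
have [h Eh] : exists h, f' (inl 1) * inl g = inl h.
  by case: (f' _) => [h|j]; [exists (h * g) | exists g].
have [h' Eh'] : exists h', f (inl h) = inl h'.
  by rewrite -Eh fM f'K; case: (f _) => [h'|j]; [exists (1 * h') | exists 1].
have -> : inl g = (inl h : star G i) * inl (h^-1 * g).
  by rewrite star_mulE /= mulKVg.
by rewrite fM Eh'; case: (f _) => [h''|j]; [exists (h' * h'') | exists h'].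
Qed.

Lemma ltn_homo_ord i m (s : 'I_i -> 'I_m) :
  (forall j l : 'I_i, j < l -> s j < s l) -> forall j : 'I_i, j <= s j.
Proof.
move=> s_lt [j]; elim: j => // j IHj lt_ji.
exact: leq_ltn_trans (IHj (ltnW lt_ji)) (s_lt (Ordinal (ltnW lt_ji)) (Ordinal lt_ji) _).
Qed.

(** The induced map on indices is strictly increasing, because products of idempotents are minima
    and f is injective, and a strictly increasing map lies above the identity. The same bound for
    the inverse will turn j <= l into an equality. *)
Lemma star_morph_inr (G H : finGroupType) i m (f : star G i -> star H m)
    (f' : star H m -> star G i) :
  {morph f : a b / a * b} -> cancel f f' -> cancel f' f ->
  forall j : 'I_i, exists2 l : 'I_m, j <= l & f (inr j) = inr l.
Proof.
move=> fM fK f'K.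
have f'M : {morph f' : a b / a * b}.
  by move=> a b; apply: (can_inj fK); rewrite fM !f'K.
have f_inr (j : 'I_i) : {l | f (inr j) = inr l}.
  (* A group element as image is impossible: the inverse maps the group into the group. *)
  case E: (f (inr j)) => [h|l]; last by exists l.
  exfalso; case: (star_morph_inl f'M fK h) => g.
  by rewrite -E fK.
pose s j := sval (f_inr j).
have sE j : f (inr j) = inr (s j) by rewrite /s; case: (f_inr j).
move=> j; exists (s j) => //.
apply: ltn_homo_ord => {}j l lt_jl; rewrite ltnNge; apply/negP => le_s.
have : f ((inr j : star G i) * inr l) = f (inr l).
  rewrite fM !sE; congr inr; apply: val_inj; exact/minn_idPr.
move/(can_inj fK) => [] /(congr1 val) /= Emin.
by move: lt_jl; rewrite -[X in _ < X]Emin ltnNge geq_minl.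
Qed.

(** Both sides are compared inside H^{*k}, which avoids a transport along i = m. *)
Lemma star_iso_map (G H : finGroupType) i m (f : star G i -> star H m) :
  {morph f : a b / a * b} -> bijective f ->
  i = m /\ exists2 psi : monoid_hom G H, bijective psi &
    forall k (le_ik : i <= k) (le_mk : m <= k) a,
      star_incl le_mk (f a) = star_map psi k (star_incl le_ik a).
Proof.
move=> fM [f' fK f'K].
have f'M : {morph f' : a b / a * b}.
  by move=> a b; apply: (can_inj fK); rewrite fM !f'K.
have f_inr := star_morph_inr fM fK f'K.
have f'_inr := star_morph_inr f'M f'K fK.
(* The last idempotent, of index i - 1, goes to an index l with i - 1 <= l < m, so i <= m; the
   inverse gives the converse. *)
have Eim : i = m.
  apply/eqP; rewrite eqn_leq; apply/andP; split.
    case: (posnP i) => [->//|i_gt0]; have lt_i : i.-1 < i by rewrite ltn_predL.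
    case: (f_inr (Ordinal lt_i)) => l le_il _.
    by rewrite -(prednK i_gt0); apply: leq_ltn_trans le_il (ltn_ord l).
  case: (posnP m) => [->//|m_gt0]; have lt_m : m.-1 < m by rewrite ltn_predL.
  case: (f'_inr (Ordinal lt_m)) => l le_ml _.
  by rewrite -(prednK m_gt0); apply: leq_ltn_trans le_ml (ltn_ord l).
split=> //.
have out_inl g : {h | f (inl g) = inl h}.
  case E: (f (inl g)) => [h|l]; first by exists h.
  by exfalso; case: (star_morph_inl fM f'K g) => h; rewrite E.
have out'_inl h : {g | f' (inl h) = inl g}.
  case E: (f' (inl h)) => [g|l]; first by exists g.
  by exfalso; case: (star_morph_inl f'M fK h) => g; rewrite E.
pose p g := sval (out_inl g); pose p' h := sval (out'_inl h).
have pE g : f (inl g) = inl (p g) by rewrite /p; case: (out_inl g).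
have p'E h : f' (inl h) = inl (p' h) by rewrite /p'; case: (out'_inl h).
have pM : {morph p : g h / g * h}.
  move=> g h; have /= := fM (inl g) (inl h).
  by rewrite star_mulE /= !pE => -[].
have p1 : p 1 = 1 by apply: (mulgI (p 1)); rewrite -pM !mulg1.
pose pmix := isUMagmaMorphism.Build G H p (conj p1 pM).
pose psi : monoid_hom G H := HB.pack p pmix.
exists psi.
  exists p' => g.
    by have := fK (inl g); rewrite pE p'E => -[].
  by have := f'K (inl g); rewrite p'E pE => -[].
move=> k le_ik le_mk [g|j] /=; first by rewrite pE.
(* Going to H^{*m} and back gives j <= l <= j' with j' = j, so the index is fixed. *)
have [l le_jl Ef] := f_inr j; rewrite Ef /=.
have [j' le_lj'] := f'_inr l; rewrite -Ef fK => -[Ej].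
congr inr; apply: val_inj => /=; apply/eqP.
by rewrite eqn_leq le_jl andbT Ej.
Qed.

End StarIso.

(** * A coordinate criterion for strong i-unigenicity *)

Section UnigenCriterion.
Variables (G : finGroupType) (i k1 k2 : nat).
Hypotheses (le_i1 : i <= k1) (le_i2 : i <= k2).
Variable M : bimodule (star G k1) (star G k2).

(** Here x is the future generator of M_i, matching the identity of G^{*i}, and c is the coordinate
    extended to all of M. On M_i the inverse of c is a |-> a x. *)
Lemma unigen_iso_of_coord (x : M) (c : M -> star G i) :
  (forall a l, c (lact a l) = star_lmul a (c l)) ->
  (forall l b, c (ract l b) = star_rmul (c l) b) ->
  c x = 1 ->
  (forall l, lact (star_e k1 le_i1) l = lact (star_incl le_i1 (c l)) x) ->
  (forall l, ract l (star_e k2 le_i2) = ract x (star_incl le_i2 (c l))) ->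
  (forall a, ract x (star_incl le_i2 a) = lact (star_incl le_i1 a) x) ->
  exists u : unigen_iso le_i1 le_i2 M, forall l, unigen_l u l = c l.
Proof.
move=> cl cr cx le re xC.
have eq_parts : rpart M (star_e k2 le_i2) = lpart M (star_e k1 le_i1).
  (* By [xC], l f_i = x c(l) = c(l) x, which e_i fixes; symmetrically for e_i l. *)
  apply/setP=> z; apply/imsetP/imsetP => -[l _ ->].
    exists (lact (star_incl le_i1 (c l)) x) => //.
    by rewrite -lactM star_e_central star_incl_e re xC.
  exists (ract x (star_incl le_i2 (c l))) => //.
  by rewrite -ractM star_incl_e le xC.
pose f (z : sub_bimod eq_parts) : star_bimod G le_i1 le_i2 := c (val z).
have f_bij : bijective f.
  exists (fun a : star G i => lpart_of eq_parts (lact (star_incl le_i1 a) x)).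
    case=> z z_in; apply: val_inj; rewrite /f /= -le -!lactM !star_eM.
    by case/imsetP: z_in => l _ ->; rewrite -lactM star_eM.
  move=> a; rewrite /f /= !cl cx star_lmul_e //.
  by rewrite star_lmul_incl -star_mulE mulg1.
have fl a z : f (lact a z) = lact a (f z) by rewrite /f /= cl.
have fr z b : f (ract z b) = ract (f z) b by rewrite /f /= cr.
exists (UnigenIso (BimodIso f_bij fl fr)) => l.
by rewrite /unigen_l /= /f /= cl star_lmul_e.
Qed.

End UnigenCriterion.

(** * Split idempotents between two objects, and conjugation by them *)

Section TwoObjects.
Variables (ob : finType) (C : fincat ob) (p q : ob).
Variables (G H : finGroupType) (k1 k2 : nat).
Variables (aP : monoid_hom (star G k1) (endo C p)).
Variables (aQ : monoid_hom (star H k2) (endo C q)).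
Hypotheses (aP_bij : bijective aP) (aQ_bij : bijective aQ).

Let compP a b : comp (aP a : C p p) (aP b : C p p) = aP (a * b).
Proof. by rewrite gmulfM. Qed.
Let compQ a b : comp (aQ a : C q q) (aQ b : C q q) = aQ (a * b).
Proof. by rewrite gmulfM. Qed.

Lemma max_split_idem : 0 < #|C p q| -> 0 < #|C q p| ->
  exists i (le_ik : i <= k1) (x : C p q) (y : C q p),
    [/\ comp x y = aP (star_e k1 le_ik),
        comp (aP (star_e k1 le_ik) : C p p) x = x,
        comp y (aP (star_e k1 le_ik) : C p p) = y &
        forall (l : C p q) (r : C q p) a,
          comp l r = aP a -> star_rank a <= i].
Proof.
case/card_gt0P=> l0 _ /card_gt0P[r0 _].
case: (aP_bij) => bP aPK bPK.
pose LR a := [exists l : C p q, exists r : C q p, comp l r == aP a].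
have LR0 : LR (bP (comp l0 r0)).
  by apply/existsP; exists l0; apply/existsP; exists r0; rewrite bPK.
case: (@arg_maxnP _ _ LR (@star_rank G k1) LR0) => z.
move=> /existsP[l /existsP[r /eqP lrE]] z_max.
pose i := star_rank z; pose le_ik := star_rank_le z.
(* A group element is cancelled by its inverse, giving e_0; any other element is already an
   idempotent. *)
have [w Ew] : exists w, z * w = star_e k1 le_ik.
  case: z @i @le_ik lrE {z_max} => [g|j] i le_ik _.
    by exists (inl g^-1); rewrite star_mulE /= mulgV.
  exists 1; rewrite mulg1 /=; by congr inr; apply: val_inj.
pose e : C p p := aP (star_e k1 le_ik).
have ee : comp e e = e by rewrite /e compP star_eM.
have xyE : comp l (comp r (aP w : C p p)) = e by rewrite compA lrE compP Ew.
(* Cutting both factors down by e makes e act trivially on them without changing their product. *)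
exists i, le_ik, (comp e l), (comp (comp r (aP w : C p p)) e).
rewrite -/e; split.
- by rewrite -compA (compA l) xyE !ee.
- by rewrite compA ee.
- by rewrite -compA ee.
move=> l' r' a Ea; apply: z_max.
by apply/existsP; exists l'; apply/existsP; exists r'; rewrite Ea.
Qed.

Variables (i : nat) (le_i1 : i <= k1) (x : C p q) (y : C q p).
Hypothesis xyE : comp x y = aP (star_e k1 le_i1).

(** Idempotency is (y x)(y x) = y e_i x = y x, and the only idempotents of H^{*k2} are the f_j. *)
Lemma split_idem_swap : comp (aP (star_e k1 le_i1) : C p p) x = x ->
  exists m (le_m2 : m <= k2), comp y x = aQ (star_e k2 le_m2).
Proof.
move=> ex; case: (aQ_bij) => bQ aQK bQK.
have [|m [le_m2 E]] := @star_idem H k2 (bQ (comp y x)).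
  by apply: (can_inj aQK); rewrite -compQ bQK -compA (compA x) xyE ex.
by exists m, le_m2; rewrite -E bQK.
Qed.

Variables (m : nat) (le_m2 : m <= k2).
Hypothesis yxE : comp y x = aQ (star_e k2 le_m2).
Hypothesis ex : comp (aP (star_e k1 le_i1) : C p p) x = x.
Hypothesis ye : comp y (aP (star_e k1 le_i1) : C p p) = y.

Lemma split_idem_iso :
  i = m /\ exists2 psi : monoid_hom G H, bijective psi &
    forall (le_i2 : i <= k2) a,
      comp y (comp (aP (star_incl le_i1 a) : C p p) x) =
      aQ (star_map psi k2 (star_incl le_i2 a)).
Proof.
case: (aP_bij) => bP aPK bPK; case: (aQ_bij) => bQ aQK bQK.
(* The projections lose nothing: y a x is fixed by f_m and x b y by e_i, which is what [fE] and
   [f'E] record. *)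
pose f (a : star G i) : star H m :=
  star_proj m (bQ (comp y (comp (aP (star_incl le_i1 a) : C p p) x))).
pose f' (b : star H m) : star G i :=
  star_proj i (bP (comp x (comp (aQ (star_incl le_m2 b) : C q q) y))).
have xf : comp x (aQ (star_e k2 le_m2) : C q q) = x.
  by rewrite -yxE compA xyE ex.
have fy : comp (aQ (star_e k2 le_m2) : C q q) y = y.
  by rewrite -yxE -compA xyE ye.
have fE a : aQ (star_incl le_m2 (f a)) =
    comp y (comp (aP (star_incl le_i1 a) : C p p) x).
  by rewrite star_projK -compQ bQK -!compA xf.
have f'E b : aP (star_incl le_i1 (f' b)) =
    comp x (comp (aQ (star_incl le_m2 b) : C q q) y).
  by rewrite star_projK -compP bPK -!compA ye.
have aPi_inj : injective (fun a => aP (star_incl le_i1 a)).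
  by move=> a b /(can_inj aPK)/star_incl_inj.
have aQi_inj : injective (fun a => aQ (star_incl le_m2 a)).
  by move=> a b /(can_inj aQK)/star_incl_inj.
have fM : {morph f : a b / a * b}.
  move=> a b; apply: aQi_inj; rewrite /= star_inclM -compQ !fE star_inclM.
  (* In (y a x)(y b x) the inner x y is e_i, which is absorbed by b. *)
  rewrite -compP -!compA; congr comp; congr comp.
  by rewrite (compA x) xyE !compA compP star_e_central star_incl_e.
have f_bij : bijective f.
  exists f' => a; [apply: aPi_inj | apply: aQi_inj]; rewrite /= ?f'E ?fE ?f'E.
    rewrite !compA xyE -!compA xyE !compA !compP.
    by rewrite star_e_central star_incl_e star_incl_e.
  rewrite !compA yxE -!compA yxE !compA !compQ.
  by rewrite star_e_central star_incl_e star_incl_e.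
have [Eim [psi psi_bij psiE]] := star_iso_map fM f_bij.
split=> //; exists psi => // le_i2 a.
by rewrite -psiE fE.
Qed.

End TwoObjects.

(** The maximal rank m of the composites r l is attained at a split idempotent y x = f_m. Then x y
    is an idempotent e_{i'} with i' = m by conjugation, and i' <= i by hypothesis. *)
Lemma split_idem_max (ob : finType) (C : fincat ob) (p q : ob)
    (G H : finGroupType) (k1 k2 : nat)
    (aP : monoid_hom (star G k1) (endo C p))
    (aQ : monoid_hom (star H k2) (endo C q)) :
  bijective aP -> bijective aQ ->
  forall i,
  (forall (l : C p q) (r : C q p) a, comp l r = aP a -> star_rank a <= i) ->
  (forall (r : C q p) (l : C p q) b, comp r l = aQ b -> star_rank b <= i).
Proof.
move=> aP_bij aQ_bij i rank_i r l b rlE.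
have L_gt0 : 0 < #|C p q| by apply/card_gt0P; exists l.
have R_gt0 : 0 < #|C q p| by apply/card_gt0P; exists r.
have [m [le_m2 [y [x [yxE fy xf rank_m]]]]] := max_split_idem aQ_bij R_gt0 L_gt0.
have [i' [le_i'1 xyE]] := split_idem_swap aP_bij yxE fy.
have [Emi _] := split_idem_iso aQ_bij aP_bij yxE xyE fy xf.
apply: leq_trans (rank_m _ _ _ rlE) _.
by have := rank_i _ _ _ xyE; rewrite star_rank_e Emi.
Qed.

(** * Hom-sets as strongly unigen bimodules *)

Section HomUnigen.
Variables (ob : finType) (C : fincat ob) (p q : ob).
Variables (G : finGroupType) (i k1 k2 : nat).
Hypotheses (le_i1 : i <= k1) (le_i2 : i <= k2).
Variables (aP : monoid_hom (star G k1) (endo C p)).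
Variables (aQ : monoid_hom (star G k2) (endo C q)).
Hypothesis aP_bij : bijective aP.
Variables (x : C p q) (y : C q p).
Hypothesis xyE : comp x y = aP (star_e k1 le_i1).
Hypothesis yxE : comp y x = aQ (star_e k2 le_i2).
Hypothesis xC : forall a, comp x (aQ (star_incl le_i2 a) : C q q) =
                          comp (aP (star_incl le_i1 a) : C p p) x.
Hypothesis yC : forall a, comp y (aP (star_incl le_i1 a) : C p p) =
                          comp (aQ (star_incl le_i2 a) : C q q) y.
Hypothesis lr_e : forall (l : C p q) (r : C q p),
  comp (comp l r) (aP (star_e k1 le_i1) : C p p) = comp l r.
Hypothesis e_lr : forall (l : C p q) (r : C q p),
  comp (aP (star_e k1 le_i1) : C p p) (comp l r) = comp l r.
Hypothesis rl_e : forall (r : C q p) (l : C p q),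
  comp (comp r l) (aQ (star_e k2 le_i2) : C q q) = comp r l.

(** The criterion applies with generator x and coordinate l |-> l y. The data are symmetric in p and
    q, so exchanging them treats R, with coordinate r |-> r x; conjugation by x and y identifies r x
    with x r. *)
Lemma hom_unigen : exists u : unigen_iso le_i1 le_i2 (hom_bimod aP aQ),
  forall l : C p q, aP (star_incl le_i1 (unigen_l u l)) = comp l y.
Proof.
case: (aP_bij) => bP aPK bPK.
have compP a b : comp (aP a : C p p) (aP b : C p p) = aP (a * b).
  by rewrite gmulfM.
have compQ a b : comp (aQ a : C q q) (aQ b : C q q) = aQ (a * b).
  by rewrite gmulfM.
have aPi_inj : injective (fun a => aP (star_incl le_i1 a)).
  by move=> a b /(can_inj aPK)/star_incl_inj.
pose c (l : C p q) : star G i := star_proj i (bP (comp l y)).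
have cE l : aP (star_incl le_i1 (c l)) = comp l y.
  by rewrite star_projK -compP bPK lr_e.
have fy : comp (aQ (star_e k2 le_i2) : C q q) y = comp y (comp x y).
  by rewrite -yxE -compA.
have [||||||u uE] := @unigen_iso_of_coord _ _ _ _ le_i1 le_i2
    (hom_bimod aP aQ) x c.
- by move=> a l; apply: aPi_inj; rewrite /= star_incl_lmul -compP !cE -compA.
- move=> l b; apply: aPi_inj; rewrite /= cE.
  (* To carry b across y, insert f_i in front of y: b f_i lies in G^{*i}, whose elements pass
     through y by [yC]. *)
  rewrite -[LHS]lr_e -xyE -!compA -fy.
  rewrite (compA (aQ b : C q q)) compQ -star_projK -yC compA -cE compP.
  by rewrite -star_inclM star_mulE -star_lmul_rmul -star_mulE mulg1.
- by apply: aPi_inj; rewrite /= cE star_incl1.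
- move=> l /=; rewrite cE -xyE -!compA -[in LHS]rl_e -yxE.
  by rewrite !compA xyE -(compA (aP _ : C p p)) e_lr.
- by move=> l /=; rewrite xC cE -yxE compA.
- by move=> a; apply: xC.
by exists u => l; rewrite uE cE.
Qed.

End HomUnigen.

(** * Assembling the isomorphism with [C3] *)

Theorem theorem1p5 (C : fincat two) (G1 G2 : finGroupType) (k1 k2 : nat)
    (aX : monoid_hom (star G1 k1) (endo C X))
    (aY : monoid_hom (star G2 k2) (endo C Y))
    (aX_bij : bijective aX) (aY_bij : bijective aY)
    (L_nonempty : 0 < #|C X Y|) (R_nonempty : 0 < #|C Y X|) :
  exists (i : nat) (le_i1 : i <= k1) (le_i2 : i <= k2)
         (psi : monoid_hom G1 G2),
    bijective psi /\
    let aY' : monoid_hom (star G1 k2) (endo C Y) :=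
      aY \o star_map psi k2 in
    let L := hom_bimod aX aY' in
    let R := hom_bimod aY' aX in
    strongly_unigen le_i1 le_i2 L /\ strongly_unigen le_i2 le_i1 R /\
    exists (uL : unigen_iso le_i1 le_i2 L) (uR : unigen_iso le_i2 le_i1 R)
           (F : cat_iso (C3 uL uR) C),
      [/\ forall a : star G1 k1, F X X a = aX a,
          forall l : C X Y, F X Y l = l,
          forall r : C Y X, F Y X r = r &
          forall b : star G1 k2, F Y Y b = aY (star_map psi k2 b)].
Proof.
have [i [le_i1 [x [y [xyE ex ye rankL]]]]] :=
  max_split_idem aX_bij L_nonempty R_nonempty.
have [m [le_i2 yxE]] := split_idem_swap aY_bij xyE ex.
have [Eim [psi psi_bij psiE]] := split_idem_iso aX_bij aY_bij xyE yxE ex ye.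
have rankR := split_idem_max aX_bij aY_bij rankL.
case: m / Eim le_i2 yxE => le_i2 yxE.
exists i, le_i1, le_i2, psi; split=> // aY' L R.
have aY'_bij : bijective aY'.
  apply: bij_comp => //; case: psi_bij => p' pK p'K.
  pose f (b : star G2 k2) : star G1 k2 :=
    match b with inl h => inl (p' h) | inr j => inr j end.
  by exists f => -[g|j] //=; rewrite ?pK ?p'K.
(* After the identification by psi, conjugation is the identity of G^{*i}; this yields the
   commutation rules [xC] and [yC]. *)
have xaY' a : comp y (comp (aX (star_incl le_i1 a) : C X X) x) =
    aY' (star_incl le_i2 a) by rewrite psiE.
have yxE' : comp y x = aY' (star_e k2 le_i2).
  by rewrite -star_incl1 -xaY' star_incl1 ex.
have aXM a b : comp (aX a : C X X) (aX b : C X X) = aX (a * b).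
  by rewrite gmulfM.
have aYM a b : comp (aY' a : C Y Y) (aY' b : C Y Y) = aY' (a * b).
  by rewrite [in RHS]gmulfM.
(* The bound passes from [aY] to [aY'] because [star_map] preserves rank. *)
have rankR' (r : C Y X) (l : C X Y) b : comp r l = aY' b -> star_rank b <= i.
  by move=> /rankR; case: b.
case: (aX_bij) (aY'_bij) => bX aXK bXK [bY aYK bYK].
have lr_e (l : C X Y) (r : C Y X) :
    comp (comp l r) (aX (star_e k1 le_i1) : C X X) = comp l r.
  by rewrite -(bXK (comp l r)) aXM star_mul_e_id // (rankL l r) // bXK.
have e_lr (l : C X Y) (r : C Y X) :
    comp (aX (star_e k1 le_i1) : C X X) (comp l r) = comp l r.
  by rewrite -[RHS]lr_e -(bXK (comp l r)) !aXM star_e_central.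
have rl_e (r : C Y X) (l : C X Y) :
    comp (comp r l) (aY' (star_e k2 le_i2) : C Y Y) = comp r l.
  by rewrite -(bYK (comp r l)) aYM star_mul_e_id // (rankR' r l) // bYK.
have e_rl (r : C Y X) (l : C X Y) :
    comp (aY' (star_e k2 le_i2) : C Y Y) (comp r l) = comp r l.
  by rewrite -[RHS]rl_e -(bYK (comp r l)) !aYM star_e_central.
have xC a : comp x (aY' (star_incl le_i2 a) : C Y Y) =
    comp (aX (star_incl le_i1 a) : C X X) x.
  by rewrite -xaY' compA xyE compA aXM star_e_central star_incl_e.
have yC a : comp y (aX (star_incl le_i1 a) : C X X) =
    comp (aY' (star_incl le_i2 a) : C Y Y) y.
  by rewrite -xaY' -!compA xyE aXM star_incl_e.
have [uL uLE] := hom_unigen aX_bij xyE yxE' xC yC lr_e e_lr rl_e.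
have [uR uRE] := hom_unigen aY'_bij yxE' xyE yC xC rl_e e_rl lr_e.
split; first by constructor.
split; first by constructor.
exists uL, uR.
pose F (p q : two) : C3 uL uR p q -> C p q :=
  match p, q with
  | X, X => fun a : star G1 k1 => aX a
  | X, Y => fun l : C X Y => l
  | Y, X => fun r : C Y X => r
  | Y, Y => fun b : star G1 k2 => aY' b
  end.
have F_bij p q : bijective (F p q).
  by case: p q => [] []; rewrite //=; exists id.
have F_id p : F p p (idm (C3 uL uR) p) = idm C p.
  by case: p; [apply: (gmulf1 (s := aX)) | apply: (gmulf1 (s := aY'))].
have F_comp p q r (f : C3 uL uR p q) (g : C3 uL uR q r) :
    F p r (comp f g) = comp (F p q f) (F q r g).
  case: p q r f g => [] [] [] f g //.
  - by rewrite /= -aXM.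
  (* The coordinate s of r equals r x in C(Y, Y), so moving it across y gives (l y) s = l (s y) = l
     (r x) y = (l r) e_i = l r. *)
  - rewrite /= -(unigen_lrE uR) star_inclM -aXM uLE -compA yC uRE.
    by rewrite -[comp (comp _ x) y]compA xyE compA lr_e.
  - rewrite /F [comp f g]/= -(unigen_lrE uL) star_inclM -aYM uRE -compA xC uLE.
    by rewrite -[comp (comp _ y) x]compA yxE' compA rl_e.
  - by rewrite /F -aYM.
by exists (CatIso F_bij F_id F_comp).
Qed.
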